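(* Let $r\ge 1$ be an integer, let $a\in\{0,1,\ldots,2^r-1\}$, and let $f\colon\mathbb Z_2\to\mathbb Z_2$ be a 1-Lipschitz function (with respect to the 2-adic metric), represented by its van der Put series $$f(x)=\sum_{m=0}^\infty 2^{\lfloor\log_2 m\rfloor}\,b_f(m)\,\chi(m,x),\qquad b_f(m)\in\mathbb Z_2 .$$ Then $f$ is ergodic on the sphere $\mathbf S_{2^{-r}}(a)=\{z\in\mathbb Z_2\colon |z-a|_2=2^{-r}\}$ if and only if the following conditions hold simultaneously: \begin{enumerate} \item $f(a+2^r)\equiv a+2^r+2^{r+1}\pmod{2^{r+2}}$; \item $|b_f(a+2^r+m\cdot 2^{r+1})|_2=1$ for all integers $m\ge 1$; \item $b_f(a+2^r+2^{r+1})\equiv 1\pmod 4$; \item $b_f(a+2^r+2^{r+2})+b_f(a+2^r+3\cdot 2^{r+1})\equiv 2\pmod 4$; \item $\sum_{m=2^{n-1}}^{2^n-1} b_f(a+2^r+m\cdot 2^{r+1})\equiv 0\pmod 4$ for all integers $n\ge 3$. \end{enumerate}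
   Context: $\mathbb Z_2$ is the ring of 2-adic integers, $|\cdot|_2$ the 2-adic absolute value. A function $f\colon\mathbb Z_2\to\mathbb Z_2$ is 1-Lipschitz if $|f(x)-f(y)|_2\le|x-y|_2$ for all $x,y\in\mathbb Z_2$. Van der Put series: put $\lfloor\log_2 0\rfloor=0$. For $m\in\{0,1,2,\ldots\}$ and $x\in\mathbb Z_2$, let $\chi(m,x)=1$ if $x\equiv m\pmod{2^{\lfloor\log_2 m\rfloor+1}}$ and $\chi(m,x)=0$ otherwise. Every continuous $f\colon\mathbb Z_2\to\mathbb Z_2$ has a unique representation $f(x)=\sum_{m\ge0}B_f(m)\chi(m,x)$ with $B_f(m)\in\mathbb Z_2$; explicitly $B_f(m)=f(m)$ for $m\in\{0,1\}$ and $B_f(m)=f(m)-f(m-2^{\lfloor\log_2 m\rfloor})$ for $m\ge2$. If $f$ is 1-Lipschitz, then $B_f(m)=2^{\lfloor\log_2 m\rfloor}b_f(m)$ for a unique $b_f(m)\in\mathbb Z_2$. The sphere satisfies $\mathbf S_{2^{-r}}(a)=a+2^r+2^{r+1}\mathbb Z_2$. The function $f$ is called ergodic on $\mathbf S_{2^{-r}}(a)$ if $f(\mathbf S_{2^{-r}}(a))\subset\mathbf S_{2^{-r}}(a)$ and the restriction of $f$ to $\mathbf S_{2^{-r}}(a)$ is measure-preserving and ergodic with respect to the Haar measure of $\mathbb Z_2$ restricted to the sphere and normalized to a probability measure (ergodic: every measurable $E\subset\mathbf S_{2^{-r}}(a)$ whose preimage under the restricted map equals $E$ has measure 0 or 1).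 *)

(* Defs.v *)
From HB Require Import structures.
From mathcomp Require Import all_boot all_order all_algebra.
From mathcomp Require Import all_classical all_reals all_analysis.
From mathcomp Require Import zify lra.

Set Implicit Arguments.
Unset Strict Implicit.
Unset Printing Implicit Defensive.

Import Order.TTheory GRing.Theory Num.Theory.

Local Open Scope classical_set_scope.
Local Open Scope ring_scope.

(** * The ring of 2-adic integers *)

(** The inverse limit of the rings Z/2^n: [res x n] is the representative of
    [x] modulo [2 ^ n] in [0, 2 ^ n). *)
Record z2 := MkZ2 {
  res : nat -> nat;
  res_compat : forall n, res n = (res n.+1 %% 2 ^ n)%N }.

Lemma z2P (x y : z2) : res x =1 res y -> x = y.
Proof.
case: x y => [u hu] [v hv] /= /funext uv; rewrite -uv in hv *.
by congr MkZ2; exact: Prop_irrelevance.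
Qed.

HB.instance Definition _ := gen_eqMixin z2.
HB.instance Definition _ := gen_choiceMixin z2.

Lemma res_mod (x : z2) n : (res x n %% 2 ^ n)%N = res x n.
Proof. by rewrite res_compat modn_mod. Qed.

Lemma res_modS (x : z2) n : (res x n.+1 %% 2 ^ n)%N = res x n.
Proof. by rewrite -res_compat. Qed.

Lemma z2_of_subproof (g : nat -> nat) :
  (forall n, g n.+1 = g n %[mod 2 ^ n]) ->
  forall n, (g n %% 2 ^ n = (g n.+1 %% 2 ^ n.+1) %% 2 ^ n)%N.
Proof. by move=> gP n; rewrite modn_dvdm ?gP// dvdn_exp2l. Qed.

Definition z2_of (g : nat -> nat) (gP : forall n, g n.+1 = g n %[mod 2 ^ n]) :
  z2 := MkZ2 (z2_of_subproof gP).

Lemma z2_zero_subproof n : 0%N = 0%N %[mod 2 ^ n]. Proof. by []. Qed.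

Lemma z2_one_subproof n : 1%N = 1%N %[mod 2 ^ n]. Proof. by []. Qed.

Lemma z2_add_subproof (x y : z2) n :
  (res x n.+1 + res y n.+1)%N = (res x n + res y n)%N %[mod 2 ^ n].
Proof. by rewrite -modnDm !res_modS. Qed.

Lemma z2_mul_subproof (x y : z2) n :
  (res x n.+1 * res y n.+1)%N = (res x n * res y n)%N %[mod 2 ^ n].
Proof. by rewrite -modnMm !res_modS. Qed.

Lemma res_lt (x : z2) n : (res x n < 2 ^ n)%N.
Proof. by rewrite -res_mod ltn_mod expn_gt0. Qed.

Lemma z2_opp_subproof (x : z2) n :
  (2 ^ n.+1 - res x n.+1)%N = (2 ^ n - res x n)%N %[mod 2 ^ n].
Proof.
apply/eqP; rewrite -(eqn_modDr (res x n)) subnK; last exact/ltnW/res_lt.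
rewrite -(res_modS x n) modnDmr subnK; last exact/ltnW/res_lt.
by rewrite expnS modnMl modnn.
Qed.

Definition z2_zero := z2_of z2_zero_subproof.
Definition z2_one := z2_of z2_one_subproof.
Definition z2_add x y := z2_of (z2_add_subproof x y).
Definition z2_opp x := z2_of (z2_opp_subproof x).
Definition z2_mul x y := z2_of (z2_mul_subproof x y).

Lemma z2_addA : associative z2_add.
Proof. by move=> x y z; apply: z2P => n /=; rewrite modnDml modnDmr addnA. Qed.

Lemma z2_addC : commutative z2_add.
Proof. by move=> x y; apply: z2P => n /=; rewrite addnC. Qed.

Lemma z2_add0 : left_id z2_zero z2_add.
Proof. by move=> x; apply: z2P => n /=; rewrite mod0n add0n res_mod. Qed.

Lemma z2_addN : left_inverse z2_zero z2_opp z2_add.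
Proof.
move=> x; apply: z2P => n /=.
by rewrite modnDml subnK ?modnn ?mod0n //; exact/ltnW/res_lt.
Qed.

Lemma z2_mulA : associative z2_mul.
Proof. by move=> x y z; apply: z2P => n /=; rewrite modnMml modnMmr mulnA. Qed.

Lemma z2_mulC : commutative z2_mul.
Proof. by move=> x y; apply: z2P => n /=; rewrite mulnC. Qed.

Lemma z2_mul1 : left_id z2_one z2_mul.
Proof. by move=> x; apply: z2P => n /=; rewrite modnMml mul1n res_mod. Qed.

Lemma z2_mulD : left_distributive z2_mul z2_add.
Proof.
by move=> x y z; apply: z2P => n /=; rewrite modnMml modnDml modnDmr mulnDl.
Qed.

Lemma z2_one_neq0 : z2_one != z2_zero.
Proof. by apply/eqP => /(congr1 (res ^~ 1%N)). Qed.

HB.instance Definition _ :=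
  GRing.isZmodule.Build z2 z2_addA z2_addC z2_add0 z2_addN.
HB.instance Definition _ := GRing.Zmodule_isComNzRing.Build z2
  z2_mulA z2_mulC z2_mul1 z2_mulD z2_one_neq0.

Lemma res0 n : res 0 n = 0%N.
Proof. by rewrite /= mod0n. Qed.

Lemma resD (x y : z2) n : res (x + y) n = ((res x n + res y n) %% 2 ^ n)%N.
Proof. by []. Qed.

Lemma resB_eq0 (x y : z2) n : (res (x - y) n == 0%N) = (res x n == res y n).
Proof.
rewrite resD /= modnDmr -[in RHS](res_mod x) -[in RHS](res_mod y).
by rewrite -(eqn_modDr (2 ^ n - res y n)) subnKC ?modnn //; exact/ltnW/res_lt.
Qed.

Lemma res_eq0W (x : z2) m n : (m <= n)%N -> res x n = 0%N -> res x m = 0%N.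
Proof.
move=> mn; rewrite -(subnKC mn); elim: (n - m)%N => [|k ih]; first by rewrite addn0.
by rewrite addnS => xk; apply: ih; rewrite res_compat xk mod0n.
Qed.

(** Congruence modulo a 2-adic integer [d]. *)
Definition z2_congr (d x y : z2) : Prop := exists z, x - y = d * z.

(** * The 2-adic absolute value *)

(** [2 ^- n] for the least [n] such that [2 ^ n.+1] does not divide [x], if
    there is one; it exists if and only if [x != 0]. *)
Definition abs2 (x : z2) : rat :=
  if pselect (exists n, res x n.+1 != 0%N) is left xn then 2 ^- ex_minn xn
  else 0.

Lemma abs2_ge0 x : 0 <= abs2 x.
Proof. by rewrite /abs2; case: pselect => // xn; rewrite invr_ge0 exprn_ge0. Qed.

Lemma abs2_le x n : (abs2 x <= 2 ^- n) = (res x n == 0%N).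
Proof.
have x00 : res x 0 = 0%N by have := res_lt x 0; case: (res x 0).
rewrite /abs2; case: pselect => [xn|xn].
  case: ex_minnP => m xm minm; rewrite ler_pV2 ?inE ?unitfE ?expf_neq0 ?exprn_gt0 //.
  rewrite ler_eXn2l ?ltr1n //; apply/idP/eqP => [nm|x0].
    case: n nm => // n nm; apply/eqP; apply: contraT => /minm.
    by rewrite leqNgt nm.
  rewrite leqNgt; apply/negP => mn; move/eqP: xm; apply.
  exact: res_eq0W x0.
rewrite invr_ge0 exprn_ge0 //; apply/esym/eqP; case: n => // n.
by apply/eqP; apply: contraT => ?; case: xn; exists n.
Qed.

Lemma abs2_0 : abs2 0 = 0.
Proof.
rewrite /abs2; case: pselect => // xn; exfalso.
by case: xn => n; rewrite res0.
Qed.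

Lemma abs2_eq0 x : abs2 x = 0 -> x = 0.
Proof.
move=> x0; apply: z2P => n; rewrite res0.
by apply/eqP; rewrite -abs2_le x0 invr_ge0 exprn_ge0.
Qed.

Lemma abs2_mono x y :
  (forall n, res y n = 0%N -> res x n = 0%N) -> abs2 x <= abs2 y.
Proof.
move=> yx; have [[n yn]|y0] : (exists n, abs2 y = 2 ^- n) \/ abs2 y = 0.
- by rewrite /abs2; case: pselect => [yn|]; [left; eexists | right].
- by rewrite yn abs2_le; apply/eqP/yx/eqP; rewrite -abs2_le yn.
- have x0 : x = 0.
    by apply: z2P => n; rewrite res0; apply: yx; rewrite (abs2_eq0 y0) res0.
  by rewrite x0 abs2_0 abs2_ge0.
Qed.

Lemma abs2_ultra x y z : abs2 (x - z) <= Num.max (abs2 (x - y)) (abs2 (y - z)).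
Proof.
have res_sub u v n : res (u - v) n = 0%N <-> res u n = res v n.
  by split => [/eqP|/eqP uv]; [rewrite resB_eq0 => /eqP | apply/eqP; rewrite resB_eq0].
have key u v : abs2 v <= abs2 u -> forall n, res u n = 0%N -> res v n = 0%N.
  by move=> vu n /eqP; rewrite -abs2_le => /(le_trans vu); rewrite abs2_le => /eqP.
rewrite le_max; have [/key h|/ltW/key h] := leP (abs2 (y - z)) (abs2 (x - y)).
- apply/orP; left; apply: abs2_mono => n xy; have := h n xy.
  by move: xy; rewrite !res_sub => -> ->.
- apply/orP; right; apply: abs2_mono => n yz; have := h n yz.
  by move: yz; rewrite !res_sub => -> ->.
Qed.

Lemma abs2_sym x y : abs2 (x - y) = abs2 (y - x).
Proof.
apply/le_anti/andP; split; apply: abs2_mono => n /eqP;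
  by rewrite resB_eq0 eq_sym -resB_eq0 => /eqP.
Qed.

Lemma abs2_triangle y x z : abs2 (x - z) <= abs2 (x - y) + abs2 (y - z).
Proof.
apply: le_trans (abs2_ultra x y z) _.
by rewrite ge_max lerDl lerDr !abs2_ge0.
Qed.

Lemma dist2xx (x : z2) : abs2 (x - x) = 0.
Proof. by rewrite subrr abs2_0. Qed.

Lemma dist2_eq0 (x y : z2) : abs2 (x - y) = 0 -> x = y.
Proof. by move/abs2_eq0/subr0_eq. Qed.

HB.instance Definition _ := isPointed.Build z2 0.
HB.instance Definition _ :=
  isMetric.Build rat z2 dist2xx dist2_eq0 abs2_sym abs2_triangle.

(** The measurable sets are the Borel sets of the metric topology. *)
HB.instance Definition _ := @isMeasurable.Build default_measure_display z2
  <<s open >> (@sigma_algebra0 _ setT open) (@sigma_algebraC z2 open)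
  (@sigma_algebra_bigcup _ setT open).

(** Together with [mu : probability z2 R] this characterises the normalized
    Haar measure of the additive group of [z2]; see [haar_exists] below. *)
Definition translation_invariant (R : realType) (mu : set z2 -> \bar R) : Prop :=
  forall (x : z2) (A : set z2), measurable A -> mu [set x + y | y in A] = mu A.

Definition lipschitz1 (f : z2 -> z2) : Prop :=
  forall x y, abs2 (f x - f y) <= abs2 (x - y).

(** The sphere of radius [2 ^- r] around [a]. *)
Definition sphere2 (r : nat) (a : z2) : set z2 :=
  [set z | abs2 (z - a) = 2 ^- r].

(** * Ergodicity of the restriction of a map to a measurable set *)

Section ergodic.
Context (R : realType) (mu : set z2 -> \bar R) (S : set z2) (f : z2 -> z2).

(** The restriction of [mu] to [S], normalized to total mass 1. *)
Definition normalized_restr (E : set z2) : R :=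
  fine (mu (E `&` S)) / fine (mu S).

(** In the next two definitions [S `&` f @^-1` E] is the preimage of [E] under
    the restricted map. *)
Definition preserves_measure_on : Prop :=
  forall E, measurable E -> E `<=` S ->
    measurable (S `&` f @^-1` E) /\
    normalized_restr (S `&` f @^-1` E) = normalized_restr E.

Definition no_invariant_set_on : Prop :=
  forall E, measurable E -> E `<=` S -> S `&` f @^-1` E = E ->
    normalized_restr E = 0 \/ normalized_restr E = 1.

Definition ergodic_on : Prop :=
  [/\ f @` S `<=` S, preserves_measure_on & no_invariant_set_on].

End ergodic.

(** * Van der Put series *)

(** [trunc_log 2 m] is the floor of the binary logarithm of [m], and is [0] for
    [m = 0]. *)
Definition vdp_chi (m : nat) (x : z2) : z2 :=
  if `[< z2_congr (2 ^+ (trunc_log 2 m).+1) x m%:R >] then 1 else 0.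

Definition vdp_series (b : nat -> z2) (x : z2) : nat -> z2 :=
  fun n => \sum_(0 <= m < n) 2 ^+ trunc_log 2 m * b m * vdp_chi m x.

Definition has_vdp_series (f : z2 -> z2) (b : nat -> z2) : Prop :=
  forall x, vdp_series b x @ \oo --> f x.

(** * Existence of the Haar measure *)

(** The uniform measure on [0, 1[, pushed forward along the map that reads the
    binary digits of [t] as the 2-adic digits of an element of [z2]. *)

Definition cyl (n j : nat) : set z2 := [set x | res x n = j].

Definition cyls : set (set z2) :=
  [set A | A = set0 \/ exists n j, A = cyl n j].

Lemma open_cyl n j : open (cyl n j).
Proof.
rewrite openE => x xj; rewrite /interior.
have e0 : (0 : rat) < 2 ^- n by rewrite invr_gt0 exprn_gt0.
apply: (filterS _ (nbhsx_ballx x (PosNum e0)%:num e0)) => y /=.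
rewrite ballEmdist /= => /ltW; rewrite [_ <= _]abs2_le resB_eq0 => /eqP xy.
by rewrite /cyl /= -xy.
Qed.

Lemma cyl_le x m n y : (m <= n)%N -> res x n = res y n -> res x m = res y m.
Proof.
move=> mn /eqP; rewrite -resB_eq0 => /eqP /(res_eq0W mn) /eqP.
by rewrite resB_eq0 => /eqP.
Qed.

Lemma measurable_cyls : (measurable : set (set z2)) = <<s cyls >>.
Proof.
apply/seteqP; split; apply: smallest_sub; try exact: smallest_sigma_algebra.
- move=> U oU.
  pose F n j : set z2 := [set x | cyl n j x /\ cyl n j `<=` U].
  have -> : U = \bigcup_n \bigcup_j F n j.
    apply/seteqP; split => [x Ux|x [n _ [j _ [xj]]]]; last exact.
    move: oU; rewrite openE => /(_ _ Ux); rewrite /interior -nbhs_ballE => -[e /= e0 eU].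
    have [n ne] : exists n, (2 ^- n : rat) < e.
      exists (Num.bound e^-1); rewrite invf_plt ?posrE ?exprn_gt0 //.
      apply: lt_trans (archi_boundP _) _; first by rewrite invr_ge0 ltW.
      by rewrite -natrX ltr_nat ltn_expl.
    exists n => //; exists (res x n) => //; split => // y yx; apply: eU.
    rewrite ballEmdist /=; apply: le_lt_trans ne.
    by rewrite [_ <= _]abs2_le resB_eq0; apply/eqP.
  apply: sigma_algebra_bigcup => n; apply: sigma_algebra_bigcup => j.
  apply: sub_sigma_algebra; have [h|h] := pselect (cyl n j `<=` U).
    by right; exists n, j; apply/seteqP; split => x // [].
  by left; apply/seteqP; split => x // [].
- move=> A [->|[n [j ->]]]; first exact: sigma_algebra0.
  by apply: sub_sigma_algebra; exact: open_cyl.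
Qed.

Lemma setI_closed_cyls : setI_closed cyls.
Proof.
have key m i n j : (m <= n)%N -> cyls (cyl m i `&` cyl n j).
  move=> mn; have [[x [xi xj]]|h] := pselect (cyl m i `&` cyl n j !=set0).
    right; exists n, j; apply/seteqP; split => [y []//|y yj]; split => //.
    have yx : res y n = res x n by rewrite (yj : res y n = j).
    by rewrite -xi; exact: cyl_le yx.
  by left; apply/seteqP; split => // x xij; case: h; exists x.
move=> A B [->|[m [i ->]]]; first by rewrite set0I; left.
case=> [->|[n [j ->]]]; first by rewrite setI0; left.
by have [mn|/ltnW mn] := leqP m n; [|rewrite setIC]; exact: key.
Qed.

Fixpoint bitrev (n k : nat) : nat :=
  if n is n'.+1 then (bitrev n' k./2 + 2 ^ n' * odd k)%N else 0%N.

Lemma bitrev_lt n k : (bitrev n k < 2 ^ n)%N.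
Proof.
elim: n k => //= n ih k; rewrite expnS mul2n -addnn.
by have := ih k./2; case: odd; rewrite ?muln1 ?muln0; lia.
Qed.

Lemma bitrev_inj n k l : (k < 2 ^ n)%N -> (l < 2 ^ n)%N ->
  bitrev n k = bitrev n l -> k = l.
Proof.
elim: n k l => [|n ih] k l; first by rewrite expn0 !ltnS !leqn0 => /eqP-> /eqP->.
rewrite expnS mul2n => kn ln /= kl.
have E : odd k = odd l.
  have := bitrev_lt n k./2; have := bitrev_lt n l./2; move: kl.
  by do 2!case: odd; rewrite ?muln1 ?muln0 //; lia.
have {}kl : bitrev n k./2 = bitrev n l./2 by move: kl; rewrite E => /addIn.
have kl2 : k./2 = l./2 by apply: ih kl; rewrite ltn_half_double.
by rewrite -(odd_double_half k) -[RHS]odd_double_half E kl2.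
Qed.

Lemma bitrev_surj n j : (j < 2 ^ n)%N -> exists2 k, (k < 2 ^ n)%N & bitrev n k = j.
Proof.
move=> jn; pose g (k : 'I_(2 ^ n)) := Ordinal (bitrev_lt n k).
have gi : injective g.
  by move=> k l /(congr1 val) /= /bitrev_inj kl; apply/val_inj/kl.
have [h _ gh] := injF_bij gi; exists (h (Ordinal jn)) => //.
by have /(congr1 val) := gh (Ordinal jn).
Qed.

Section digits.
Context {R : realType}.

Lemma truncS (t : R) n :
  (Num.trunc (2 ^+ n.+1 * t))./2 = Num.trunc (2 ^+ n * t).
Proof.
have [t0|t0] := leP 0 t; last first.
  have neg m : Num.trunc (2 ^+ m * t) = 0%N.
    apply/truncn0Pn; rewrite -ltNge; apply: lt_trans ltr01.
    by rewrite pmulr_rlt0 ?exprn_gt0.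
  by rewrite !neg.
have p0 m : 0 <= 2 ^+ m * t by rewrite mulr_ge0 ?exprn_ge0.
apply/esym/truncn_def; have /andP[] := truncn_itv (p0 n.+1).
set k := Num.trunc _; rewrite exprS -mulrA => h1 h2; apply/andP; split.
  have : (k./2.*2)%:R <= 2 * (2 ^+ n * t).
    apply: le_trans h1; rewrite ler_nat -[leqRHS]odd_double_half; lia.
  by rewrite -muln2 natrM; lra.
have : 2 * (2 ^+ n * t) < (k./2.+1.*2)%:R.
  apply: lt_le_trans h2 _; rewrite ler_nat -[leqLHS]/(k.+1).
  by rewrite -{1}(odd_double_half k); case: odd; lia.
by rewrite -muln2 natrM; lra.
Qed.

Lemma digits_subproof (t : R) n :
  bitrev n.+1 (Num.trunc (2 ^+ n.+1 * t)) = bitrev n (Num.trunc (2 ^+ n * t))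
  %[mod 2 ^ n].
Proof. by rewrite /= truncS addnC mulnC modnMDl. Qed.

Definition digits (t : R) : z2 := z2_of (digits_subproof t).

Lemma res_digits t n : res (digits t) n = bitrev n (Num.trunc (2 ^+ n * t)).
Proof. by rewrite /= modn_small ?bitrev_lt. Qed.

Lemma preimage_digits_cyl n j : digits @^-1` cyl n j =
  [set t | bitrev n (Num.trunc (2 ^+ n * t)) = j].
Proof. by apply/seteqP; split=> t; rewrite /mkset -res_digits. Qed.

Lemma measurable_trunc n k : measurable [set t : R | Num.trunc (2 ^+ n * t) = k].
Proof.
have m l : measurable [set t : R | (l < Num.trunc (2 ^+ n * t))%N].
  have -> : [set t : R | (l < Num.trunc (2 ^+ n * t))%N] =
            `[l.+1%:R / 2 ^+ n, +oo[%classic.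
    apply/seteqP; split => t /=; rewrite in_itv /= andbT truncn_gt_nat
      ler_pdivrMr ?exprn_gt0 // mulrC //.
  exact: measurable_itv.
case: k => [|k].
  have -> : [set t : R | Num.trunc (2 ^+ n * t) = 0%N] =
      ~` [set t | (0 < Num.trunc (2 ^+ n * t))%N].
    by apply/seteqP; split => t /=; [move=> -> | case: Num.trunc].
  exact: measurableC.
have -> : [set t : R | Num.trunc (2 ^+ n * t) = k.+1%N] =
    [set t | (k < Num.trunc (2 ^+ n * t))%N] `\`
    [set t | (k.+1 < Num.trunc (2 ^+ n * t))%N].
  apply/seteqP; split => t /=; first by move=> ->; rewrite ltnn.
  by move=> [h /negP]; rewrite -leqNgt => h'; apply/eqP; rewrite eqn_leq h' h.
exact: measurableD.
Qed.

Lemma measurable_digits : measurable_fun [set: R] digits.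
Proof.
apply: (measurability _ measurable_cyls) => _ [A [->|[n [j ->]]] <-].
  by rewrite preimage_set0 setI0.
rewrite setTI preimage_digits_cyl.
have -> : [set t : R | bitrev n (Num.trunc (2 ^+ n * t)) = j] =
    \bigcup_(k in [set k | bitrev n k = j])
      [set t : R | Num.trunc (2 ^+ n * t) = k].
  apply/seteqP; split => [t tj|t [k kj tk]] /=; last by rewrite tk.
  by exists (Num.trunc (2 ^+ n * t)).
by apply: bigcup_measurable => k _; exact: measurable_trunc.
Qed.

Let mI : measurable (`[0, 1[%classic : set R). Proof. exact: measurable_itv. Qed.

Definition haar2 : set z2 -> \bar R :=
  pushforward (mrestr (@lebesgue_measure R) mI) digits.

Let haar2_0 : haar2 set0 = 0%E.
Proof. by rewrite /haar2 /pushforward preimage_set0 /mrestr set0I measure0. Qed.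

Let haar2_ge0 A : (0 <= haar2 A)%E.
Proof. by rewrite /haar2 /pushforward /mrestr; exact: measure_ge0. Qed.

Let measurable_pre A : measurable A -> measurable (digits @^-1` A).
Proof. by move=> mA; rewrite -[X in measurable X]setTI; exact: measurable_digits. Qed.

Let haar2_sigma_additive : semi_sigma_additive haar2.
Proof.
move=> F mF tF mUF; rewrite /haar2 /pushforward preimage_bigcup.
apply: measure_semi_sigma_additive.
- by move=> n; exact: measurable_pre.
- apply/trivIsetP => /= i j _ _ ij; rewrite -preimage_setI.
  by move/trivIsetP : tF => /(_ _ _ _ _ ij) ->//; rewrite preimage_set0.
- by rewrite -preimage_bigcup; exact: measurable_pre.
Qed.

HB.instance Definition _ := isMeasure.Build _ _ _ haar2
  haar2_0 haar2_ge0 haar2_sigma_additive.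

Lemma haar2E A :
  haar2 A = lebesgue_measure (digits @^-1` A `&` `[0, 1[%classic).
Proof. by []. Qed.

Lemma haar2T : haar2 setT = 1%E.
Proof.
rewrite haar2E preimage_setT setTI lebesgue_measure_itv /= lte_fin ltr01.
by rewrite oppr0 adde0.
Qed.

HB.instance Definition _ := Measure_isProbability.Build _ _ _ haar2 haar2T.

Lemma haar2_cyl n j : (j < 2 ^ n)%N -> haar2 (cyl n j) = (2 ^- n)%:E.
Proof.
move=> /bitrev_surj[k kn kj].
have p0 : (0 : R) < 2 ^+ n by rewrite exprn_gt0.
have -> : haar2 (cyl n j) =
    lebesgue_measure (`[k%:R / 2 ^+ n, k.+1%:R / 2 ^+ n[%classic : set R).
  rewrite haar2E preimage_digits_cyl; congr (lebesgue_measure _).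
  apply/seteqP; split => t.
    rewrite /= in_itv /=.
    move=> -[tj /andP[t0 t1]].
    have u0 : 0 <= 2 ^+ n * t by rewrite mulr_ge0 ?exprn_ge0.
    have tk : Num.trunc (2 ^+ n * t) = k.
      apply: (@bitrev_inj n) => //; last by rewrite tj kj.
      by rewrite truncn_lt_nat // natrX -[ltRHS]mulr1 ltr_pM2l.
    have := truncn_itv u0; rewrite tk in_itv /=.
    by rewrite ler_pdivrMr // ltr_pdivlMr // mulrC.
  rewrite /= in_itv /= ler_pdivrMr // ltr_pdivlMr // mulrC => tk.
  rewrite (truncn_def tk).
  split => //; case/andP: tk => tk1 tk2; rewrite in_itv /=; apply/andP; split.
    by rewrite -(pmulr_rge0 _ p0); apply: le_trans tk1.
  rewrite -(ltr_pM2l p0) mulr1; apply: lt_le_trans tk2 _.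
  by rewrite -natrX ler_nat.
rewrite lebesgue_measure_itv /= lte_fin ltr_pM2r ?invr_gt0 // ltr_nat ltnSn.
by rewrite -EFinB -mulrBl -natrB // subSnn mul1r.
Qed.

Lemma haar2_translation_invariant : translation_invariant haar2.
Proof.
move=> x A mA.
have addx : [set x + y | y in A] = (fun z => z - x) @^-1` A.
  apply/seteqP; split => [_ [y Ay <-]|z Az] /=; first by rewrite addrC addKr.
  by exists (z - x) => //; rewrite addrC subrK.
have cyl_lt n j y : cyl n j y -> (j < 2 ^ n)%N by move=> <-; exact: res_lt.
have precyl n j : (j < 2 ^ n)%N ->
    (fun z => z - x) @^-1` cyl n j = cyl n ((j + res x n) %% 2 ^ n).
  move=> jn; have Q z : res z n = ((res (z - x)%R n + res x n) %% 2 ^ n)%N.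
    by rewrite -resD subrK.
  apply/seteqP; split => z; rewrite /cyl /preimage /mkset.
    by rewrite [res z n]Q => ->.
  rewrite [res z n]Q => /eqP; rewrite eqn_modDr.
  by rewrite res_mod modn_small // => /eqP.
have msub : measurable_fun setT (fun z : z2 => z - x).
  apply: (measurability _ measurable_cyls) => _ [B [->|[n [j ->]]] <-].
    by rewrite preimage_set0 setI0.
  rewrite setTI; have [jn|jn] := ltnP j (2 ^ n).
    rewrite precyl //; rewrite measurable_cyls; apply: sub_sigma_algebra.
    by right; do 2!eexists.
  rewrite (_ : _ @^-1` _ = set0) //; apply/seteqP; split => // z /cyl_lt.
  by rewrite ltnNge jn.
pose subx : {mfun z2 >-> z2} := mfun_Sub (mem_set msub).
rewrite addx -[LHS]/(distribution haar2 subx A).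
apply: (@measure_unique _ R _ cyls (fun=> cyl 0 0)) => //.
- exact: measurable_cyls.
- exact: setI_closed_cyls.
- by move=> _; right; exists 0%N, 0%N.
- apply/seteqP; split => // z _; exists 0%N => //.
  by have := res_lt z 0; rewrite /cyl /=; case: (res z 0).
- move=> _ [->|[n [j ->]]]; first by rewrite !measure0.
  have [jn|jn] := ltnP j (2 ^ n).
    rewrite /distribution /pushforward /= precyl // [in RHS]haar2_cyl // haar2_cyl //.
    by rewrite ltn_mod expn_gt0.
  rewrite (_ : cyl n j = set0) ?measure0 //; apply/seteqP; split => // z /cyl_lt.
  by rewrite ltnNge jn.
- by move=> _; rewrite /distribution /pushforward /= precyl // haar2_cyl ?ltn_mod // ltry.
Qed.

End digits.

Lemma haar_exists (R : realType) :
  exists mu : probability z2 R, translation_invariant mu.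
Proof. by exists haar2; exact: haar2_translation_invariant. Qed.

(* Main.v *)
Require Import Defs.
From mathcomp Require Import all_boot all_order all_algebra.
From mathcomp Require Import all_classical all_reals all_analysis.
From mathcomp Require Import ring.

Set Implicit Arguments.
Unset Strict Implicit.
Unset Printing Implicit Defensive.

Import Order.TTheory GRing.Theory Num.Theory.

Local Open Scope classical_set_scope.
Local Open Scope ring_scope.

(** Write [q = r + 1] and [c = a + 2 ^ r], so that the sphere is [c + 2 ^ q * Z2].
    A 1-Lipschitz [f] mapping it to itself has the form
    [f (c + 2 ^ q * t) = c + 2 ^ q * g t] with [g] 1-Lipschitz, and is ergodic
    on it iff [g] permutes the residues modulo [2 ^ n] in a single cycle for
    all [n].  If this holds for [n], it holds for [n.+1] iff
    [g (x + 2 ^ n) = g x + 2 ^ n] modulo [2 ^ n.+1], i.e. the coefficients of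
    indices [2 ^ n <= m < 2 ^ n.+1] are odd, and the [2 ^ n]-th iterate of [g]
    sends [0] to [2 ^ n] modulo [2 ^ n.+1].  That iterate is congruent to the
    sum of [g x - x] over [x < 2 ^ n], and the excess of this sum over [2 ^ n]
    satisfies a recursion in [n] whose increment is
    [2 ^ n * (b (2 ^ n) + ... + b (2 ^ n.+1 - 1) - 2 ^ n)]. *)

(** * Residues modulo powers of two, divisibility and the absolute value *)

Lemma res_natr k n : res k%:R n = (k %% 2 ^ n)%N.
Proof.
elim: k => [|k ih]; first by rewrite res0 mod0n.
by rewrite -addn1 natrD resD ih /= modnDml modnDmr.
Qed.

Lemma resM (x y : z2) n : res (x * y) n = ((res x n * res y n) %% 2 ^ n)%N.
Proof. by []. Qed.

Lemma res_at0 x : res x 0 = 0%N.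
Proof. by have := res_lt x 0; case: (res x 0). Qed.

Lemma res_leq_mod x m n : (m <= n)%N -> (res x n %% 2 ^ m)%N = res x m.
Proof.
move=> mn; rewrite -(res_natr (res x n) m).
by apply: (cyl_le mn); rewrite res_natr res_mod.
Qed.

Lemma res_expn n : res (2 ^+ n) n = 0%N.
Proof. by rewrite -natrX res_natr modnn. Qed.

Lemma eq_res_dvdP x n : res x n = 0%N <-> exists z, x = 2 ^+ n * z.
Proof.
split=> [x0|[z ->]]; last by rewrite resM res_expn mul0n mod0n.
(* The quotient by [2 ^ n] is obtained by dropping the [n] lowest digits; [gP] is the coherence of
   what remains. *)
have gP m : (res x (n + m.+1) %/ 2 ^ n = res x (n + m) %/ 2 ^ n %[mod 2 ^ m])%N.
  rewrite -(res_leq_mod x (n := n + m.+1) (m := n + m)) ?leq_add2l //.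
  by rewrite expnD mulnC -modn_divl modn_mod.
exists (z2_of gP); apply: z2P => m.
rewrite resM -natrX res_natr /= modnMml modnMmr mulnC divnK.
  by rewrite res_leq_mod // leq_addl.
by rewrite /dvdn res_leq_mod ?x0 // leq_addr.
Qed.

Lemma z2_congrP n x y : z2_congr (2 ^+ n) x y <-> res x n = res y n.
Proof.
rewrite /z2_congr -eq_res_dvdP.
by split=> [/eqP|/eqP h]; [|apply/eqP]; rewrite resB_eq0 // => /eqP.
Qed.

(** By induction it suffices that [2 * x = 0] forces [x = 0]: the residue of [2 * x] modulo
    [2 ^ n.+1] is twice that of [x] modulo [2 ^ n]. *)
Lemma z2_mulX2I k : injective (fun x : z2 => 2 ^+ k * x).
Proof.
move=> x y /eqP; rewrite -subr_eq0 -mulrBr => /eqP xy; apply/subr0_eq.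
move: (x - y) xy => {x y} x; elim: k => [|k ih]; first by rewrite mul1r.
rewrite exprS -mulrA => x0; apply: ih; move: (2 ^+ k * x) x0 => {}x x0.
apply: z2P => n; rewrite res0 -(res_leq_mod x (leqnSn n)).
have /eqP := congr1 (res ^~ n.+1) x0.
rewrite res0 mulrDl mul1r resD addnn -mul2n expnS -muln_modr muln_eq0 /=.
by move/eqP.
Qed.

Lemma res_mulX2 k n x y :
  res (2 ^+ k * x) (k + n) = res (2 ^+ k * y) (k + n) <-> res x n = res y n.
Proof.
rewrite -!z2_congrP; split=> -[z zE]; exists z.
  by apply: (@z2_mulX2I k); rewrite mulrA -exprD mulrBr.
by rewrite -mulrBr zE exprD mulrA.
Qed.

Lemma eq_resD n (x y u v : z2) :
  res x n = res y n -> res u n = res v n -> res (x + u) n = res (y + v) n.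
Proof. by rewrite !resD => -> ->. Qed.

Lemma eq_res_addr n (x y z : z2) :
  res (x + z) n = res (y + z) n <-> res x n = res y n.
Proof.
split=> [h|h]; last exact: eq_resD.
by rewrite -(addrK z x) -(addrK z y); exact: eq_resD.
Qed.

Lemma eq_res_addl0 n (x z : z2) : res (x + z) n = res x n <-> res z n = 0%N.
Proof. by rewrite -(res0 n) -(eq_res_addr n z 0 x) add0r addrC. Qed.

Lemma res_mulX2_eq0 k n x : res (2 ^+ k * x) (k + n) = 0%N <-> res x n = 0%N.
Proof. by have := res_mulX2 k n x 0; rewrite mulr0 !res0. Qed.

Lemma eq_res_sub n (x y : z2) : res (x - y) n = 0%N <-> res x n = res y n.
Proof. by split=> [/eqP|/eqP h]; [|apply/eqP]; rewrite resB_eq0 // => /eqP. Qed.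

Lemma abs2_eqP x n :
  abs2 x = 2 ^- n <-> (res x n = 0%N /\ res x n.+1 != 0%N).
Proof.
split=> [xn|[x0 x1]].
  split; first by apply/eqP; rewrite -abs2_le xn.
  rewrite -abs2_le xn -ltNge ltf_pV2 ?posrE ?exprn_gt0 //.
  by rewrite ltr_eXn2l ?ltr1n.
rewrite /abs2; case: pselect => [ex|[]]; last by exists n.
case: ex_minnP => m xm minm; congr (_ ^- _); apply/eqP; rewrite eqn_leq minm //=.
by rewrite leqNgt; apply/negP => mn; case/negP: xm; apply/eqP/(res_eq0W mn).
Qed.

Lemma res1E x : res x 1 = odd (res x 1) :> nat.
Proof. by have := res_lt x 1; case: (res x 1) => [|[|]]. Qed.

Lemma abs2_eq1P x : abs2 x = 1 <-> res x 1 = 1%N.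
Proof.
rewrite -[1]invr1 -[1 in X in X <-> _](expr0 2) abs2_eqP res_at0.
by rewrite res1E; case: odd; split=> // -[].
Qed.

(** * Single cycles modulo powers of two and their lifting *)

Section odometer.
Variable g : z2 -> z2.

(** [g] permutes the residues modulo [2 ^ n] in a single cycle. *)
Definition odometer n := forall k l,
  res (iter k g 0) n = res (iter l g 0) n <-> k = l %[mod 2 ^ n].

Hypothesis g_res : forall n x y, res x n = res y n -> res (g x) n = res (g y) n.

Lemma res_iter n k x y : res x n = res y n ->
  res (iter k g x) n = res (iter k g y) n.
Proof. by move=> xy; elim: k => //= k ih; exact: g_res. Qed.

(** The first [2 ^ n] iterates have distinct residues, and an injective self-map of a finite set is
    onto. *)
Lemma odometer_surj n i : odometer n -> (i < 2 ^ n)%N ->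
  exists2 k, (k < 2 ^ n)%N & res (iter k g 0) n = i.
Proof.
move=> on lti; pose h (k : 'I_(2 ^ n)) := Ordinal (res_lt (iter k g 0) n).
have hI : injective h.
  move=> k l /(congr1 val) /= /on; rewrite !modn_small // => kl; exact: val_inj.
have [h' _ hK] := injF_bij hI; exists (h' (Ordinal lti)) => //.
by have /(congr1 val) := hK (Ordinal lti).
Qed.

(** For a [g] compatible with residues, this means that the two lifts modulo [2 ^ n.+1] of any class
    modulo [2 ^ n] have different images. *)
Definition flips n := forall x, res (g (x + 2 ^+ n)) n.+1 = res (g x + 2 ^+ n) n.+1.

(** The difference is [2 ^ n * z], and modulo [2 ^ n.+1] only the parity of [z] counts. *)
Lemma flip_res n x y : res x n = res y n ->
  res x n.+1 = res y n.+1 \/ res x n.+1 = res (y + 2 ^+ n) n.+1.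
Proof.
move/eq_res_sub/eq_res_dvdP => [z xyz].
rewrite (_ : x = 2 ^+ n * z + y); last by rewrite -xyz subrK.
have z1 : res z 1 = res ((res z 1)%:R) 1 by rewrite res_natr res_mod.
have -> : res (2 ^+ n * z + y) n.+1 = res (2 ^+ n * (res z 1)%:R + y) n.+1.
  by apply/eq_res_addr; rewrite -(addn1 n); apply/res_mulX2; exact: z1.
rewrite res1E; case: odd; rewrite ?mulr0 ?add0r ?mulr1; [right|by left].
by rewrite addrC.
Qed.

Lemma res_add_expn_neq n x : res (x + 2 ^+ n) n.+1 <> res x n.+1.
Proof.
move/eq_res_addl0; rewrite -natrX res_natr modn_small ?ltn_exp2l // => /eqP.
by rewrite expn_eq0.
Qed.

Lemma res_add_expnL n (x : z2) : res (x + 2 ^+ n) n = res x n.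
Proof. by rewrite -[in RHS](addr0 x); apply: eq_resD; rewrite // res0 res_expn. Qed.

(** If both lifts of a class had the same image, the orbit of [0] would coincide at times [k.+1] and
    [l.+1], hence at [k] and [l], where it passes through the two distinct lifts. *)
Lemma odometer_flips n : odometer n.+1 -> flips n.
Proof.
move=> on x; have [k _ kx] := odometer_surj on (res_lt x n.+1).
have [l _ lx] := odometer_surj on (res_lt (x + 2 ^+ n) n.+1).
have gx : res (g (x + 2 ^+ n)) n = res (g x) n.
  by apply: g_res; rewrite res_add_expnL.
case: (flip_res gx) => // E; exfalso.
have : res (iter l.+1 g 0) n.+1 = res (iter k.+1 g 0) n.+1.
  by rewrite /= (g_res lx) (g_res kx) E.
move/on; rewrite -addn1 -(addn1 k) => /eqP; rewrite eqn_modDr => /eqP/on.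
by rewrite lx kx; apply: res_add_expn_neq.
Qed.

(** Either both differences vanish modulo [2 ^ n.+1], or both are [2 ^ n] there. *)
Lemma flips_sub n x y : flips n -> res x n = res y n ->
  res (g x - g y) n.+1 = res (x - y) n.+1.
Proof.
move=> fn /flip_res[xy|xy].
  have /eq_res_sub -> := xy.
  by apply/eq_res_sub; exact: g_res.
have -> : res (x - y) n.+1 = res (2 ^+ n) n.+1.
  by rewrite -(addKr y (2 ^+ n)) [- y + _]addrC; apply/eq_res_addr.
rewrite -(addKr (g y) (2 ^+ n)) [- g y + _]addrC; apply/eq_res_addr.
by rewrite -fn; exact: g_res.
Qed.

(* Modulo [2 ^ n.+1] the drift [g - id] only depends on the class modulo
   [2 ^ n], and the orbit of [0] meets each class once in [2 ^ n] steps. *)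
Lemma res_iter_expn n : odometer n -> flips n ->
  res (iter (2 ^ n) g 0) n.+1 = res (\sum_(i < 2 ^ n) (g i%:R - i%:R)) n.+1.
Proof.
move=> on fn; pose x k : z2 := (res (iter k g 0) n)%:R.
have orbit_drift K : res (iter K g 0) n.+1 = res (\sum_(k < K) (g (x k) - x k)) n.+1.
  elim: K => [|K ih]; first by rewrite big_ord0.
  have -> : iter K.+1 g 0 = iter K g 0 + (g (iter K g 0) - iter K g 0).
    by rewrite addrC subrK.
  rewrite big_ord_recr; apply: eq_resD; first exact: ih.
  have xK : res (iter K g 0) n = res (x K) n by rewrite res_natr res_mod.
  have := flips_sub fn xK; rewrite -2!z2_congrP => -[z zE]; exists z.
  by rewrite -zE; ring.
rewrite orbit_drift; congr (res _ _).
pose h (k : 'I_(2 ^ n)) := Ordinal (res_lt (iter k g 0) n).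
have hI : injective h.
  move=> k l /(congr1 val) /= /on; rewrite !modn_small // => kl; exact: val_inj.
by rewrite [RHS](reindex_inj hI).
Qed.

(** After [2 ^ n] steps the orbit is back at [0] modulo [2 ^ n], so modulo [2 ^ n.+1] it is at [0]
    or at [2 ^ n]; the cycle has doubled its length exactly in the second case. *)
Lemma odometerSP n : odometer n -> flips n ->
  odometer n.+1 <-> res (\sum_(i < 2 ^ n) (g i%:R - i%:R)) n.+1 = res (2 ^+ n) n.+1.
Proof.
move=> on fn; rewrite -res_iter_expn //; split=> [oSn|return_half].
  have : res (iter (2 ^ n) g 0) n = res 0 n by apply/(on _ 0%N); rewrite modnn mod0n.
  case/flip_res; last by rewrite add0r.
  by move/(oSn _ 0%N) => /eqP; rewrite mod0n modn_small ?ltn_exp2l // expn_eq0.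
(* By [flips], each round of [2 ^ n] steps displaces the whole orbit by [2 ^ n]; two times thus
   agree modulo [2 ^ n.+1] iff they are an even number of rounds apart. *)
have shift k j : res (iter (j * 2 ^ n + k) g 0) n.+1 =
                 res (iter k g 0 + 2 ^+ n * j%:R) n.+1.
  elim: j => [|j ih]; first by rewrite mulr0 addr0.
  rewrite mulSn -addnA addnC iterD (res_iter _ return_half).
  have step m : res (iter m g (2 ^+ n)) n.+1 = res (iter m g 0 + 2 ^+ n) n.+1.
    elim: m => [|m ihm]; first by rewrite add0r.
    by rewrite !iterS -fn; exact: g_res.
  rewrite step -(natr1 j) mulrDr mulr1 addrA.
  by apply/eq_res_addr.
have main k l : (k <= l)%N ->
    res (iter k g 0) n.+1 = res (iter l g 0) n.+1 <-> k = l %[mod 2 ^ n.+1].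
  move=> kl; split=> [E|/eqP].
    have : k = l %[mod 2 ^ n] by apply/on; exact: cyl_le E.
    move/eqP; rewrite eq_sym eqn_mod_dvd // => /dvdnP[j jE].
    have lE : l = (j * 2 ^ n + k)%N by rewrite -jE subnK.
    move: E; rewrite lE shift => /esym/eq_res_addl0.
    rewrite -(addn1 n) => /res_mulX2_eq0; rewrite res_natr => /eqP jd.
    apply/esym/eqP; rewrite -[in X in _ == X](add0n k) eqn_modDr mod0n.
    by rewrite expnD mulnC -muln_modr muln_eq0 jd orbT.
  rewrite eq_sym eqn_mod_dvd // => /dvdnP[j jE].
  rewrite -(subnK kl) jE expnS mulnA shift; apply/esym/eq_res_addl0.
  by rewrite natrM mulrCA -exprSr resM res_expn muln0 mod0n.
move=> k l; have [/main//|/ltnW/main [h1 h2]] := leqP k l.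
by split=> /esym h; apply/esym; auto.
Qed.

Lemma odometer0 : odometer 0.
Proof. by move=> k l; rewrite !res_at0 !modn1. Qed.

End odometer.

(** * The single-cycle criterion in terms of coefficients *)

Section coefficients.
Variables (g : z2 -> z2) (b : nat -> z2).
Hypothesis g_res : forall n x y, res x n = res y n -> res (g x) n = res (g y) n.
(** At [n = 0] this reads [g 1 = g 0 + b 1], so [b 1] is a difference, unlike the van der Put
    coefficient of [g] at 1. It fits the coefficients of [f] along the sphere. *)
Hypothesis gb : forall n i, (i < 2 ^ n)%N ->
  g (i + 2 ^ n)%:R = g i%:R + 2 ^+ n * b (i + 2 ^ n)%N.

(** At the representatives [i < 2 ^ n], [gb] turns the flip into oddness of [b (i + 2 ^ n)];
    compatibility with residues extends it to all of [z2]. *)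
Lemma flipsP n :
  flips g n <-> forall i, (i < 2 ^ n)%N -> res (b (i + 2 ^ n)%N) 1 = 1%N.
Proof.
have natP i : (i < 2 ^ n)%N ->
    res (g (i%:R + 2 ^+ n)) n.+1 = res (g i%:R + 2 ^+ n) n.+1 <->
    res (b (i + 2 ^ n)%N) 1 = 1%N.
  move=> lti; rewrite -natrX -natrD gb //.
  rewrite ![g i%:R + _]addrC eq_res_addr natrX.
  by have := res_mulX2 n 1 (b (i + 2 ^ n)%N) 1; rewrite mulr1 addn1.
split=> [fn i lti|bn x]; first exact/natP.
set y : z2 := (res x n)%:R.
have xy : res x n = res y n by rewrite res_natr res_mod.
have gy : res (g (y + 2 ^+ n)) n.+1 = res (g y + 2 ^+ n) n.+1.
  by apply/natP; [exact: res_lt | exact/bn/res_lt].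
(* Flipping digit [n] twice restores it, which settles the [x] whose digit [n] is 1. *)
have add_twice u : res (u + 2 ^+ n + 2 ^+ n) n.+1 = res u n.+1.
  rewrite -addrA (_ : 2 ^+ n + 2 ^+ n = 2 ^+ n.+1) ?res_add_expnL //.
  by rewrite exprS mulrDl mul1r.
case: (flip_res xy) => {}xy.
- transitivity (res (g (y + 2 ^+ n)) n.+1); first by apply/g_res; exact/eq_res_addr.
  by rewrite gy; apply/eq_res_addr; exact/esym/g_res.
- transitivity (res (g y) n.+1).
    by apply: g_res; rewrite -[RHS]add_twice; apply/eq_res_addr.
  by rewrite -[LHS]add_twice; apply/eq_res_addr; rewrite -gy; exact/esym/g_res.
Qed.

(** It vanishes modulo [2 ^ n.+1] exactly when the criterion of [odometerSP] holds. *)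
Definition defect n : z2 := \sum_(i < 2 ^ n) (g i%:R - i%:R) - 2 ^+ n.

Definition block n : z2 := \sum_(2 ^ n <= m < 2 ^ n.+1) b m.

(** By [gb], the upper half of the sum repeats the lower half, with the extra terms
    [2 ^ n * (b (i + 2 ^ n) - 1)]. *)
Lemma defectS n : defect n.+1 = 2 * defect n + 2 ^+ n * (block n - 2 ^+ n).
Proof.
rewrite /defect -(big_mkord xpredT (fun i => g i%:R - i%:R)).
rewrite -(big_mkord xpredT (fun i => g i%:R - i%:R)).
have le2 : (2 ^ n <= 2 ^ n.+1)%N by rewrite leq_exp2l.
rewrite (big_cat_nat (leq0n _) le2).
have shift (F : nat -> z2) : \sum_(2 ^ n <= i < 2 ^ n.+1) F i =
    \sum_(0 <= i < 2 ^ n) F (i + 2 ^ n)%N.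
  by rewrite -{1}(add0n (2 ^ n)%N) big_addn expnS mul2n -addnn addnK.
rewrite /block !shift.
rewrite (_ : \sum_(0 <= i < 2 ^ n) (g (i + 2 ^ n)%:R - (i + 2 ^ n)%:R) =
   \sum_(0 <= i < 2 ^ n) (g i%:R - i%:R) +
   2 ^+ n * (\sum_(0 <= i < 2 ^ n) b (i + 2 ^ n)%N - 2 ^+ n)); last first.
  have c : \sum_(0 <= i < 2 ^ n) (2 ^+ n : z2) = 2 ^+ n * 2 ^+ n.
    by rewrite sumr_const_nat subn0 -[LHS]mulr_natr natrX.
  rewrite mulrBr mulr_sumr -c -sumrB -big_split /=.
  by apply: eq_big_nat => i /andP[_ lti]; rewrite gb // natrD natrX; ring.
by rewrite exprS /=; ring.
Qed.

(** If [2 ^ n.+1] divides [defect n], the term [2 * defect n] disappears modulo [2 ^ n.+2], and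
    dividing the other term by [2 ^ n] leaves a condition modulo 4. *)
Lemma defect_vanishP :
  (forall n, res (defect n) n.+1 = 0%N) <->
  res (g 0) 1 = 1%N /\ forall n, res (block n) 2 = res (2 ^+ n) 2.
Proof.
have d0 : res (defect 0) 1 = 0%N <-> res (g 0) 1 = 1%N.
  by rewrite /defect big_ord_recl big_ord0 addr0 subr0 eq_res_sub expr0.
have dS n : res (defect n) n.+1 = 0%N ->
    res (defect n.+1) n.+2 = 0%N <-> res (block n) 2 = res (2 ^+ n) 2.
  move=> /eq_res_dvdP[z dz]; rewrite -[X in _ <-> X]eq_res_sub.
  rewrite -[X in _ <-> X](res_mulX2_eq0 n) addn2 defectS dz mulrA -exprS addrC.
  have /eq_res_addl0 -> // : res (2 ^+ n.+2 * z) n.+2 = 0%N.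
  by rewrite resM res_expn mul0n mod0n.
split=> [d|[g0 bn]]; first by split=> [|n]; [exact/d0 | apply/dS].
by elim=> [|n ih]; [exact/d0 | apply/dS].
Qed.

Lemma odometerP :
  (forall n, odometer g n) <->
  [/\ res (g 0) 1 = 1%N, forall m, (1 <= m)%N -> res (b m) 1 = 1%N &
      forall n, res (block n) 2 = res (2 ^+ n) 2].
Proof.
have oddP : (forall n, flips g n) <-> forall m, (1 <= m)%N -> res (b m) 1 = 1%N.
  split=> [fn m m1|bm n]; last first.
    by apply/flipsP => i _; apply: bm; rewrite addn_gt0 expn_gt0 orbT.
  (* Removing the leading binary digit writes [m] as [i + 2 ^ n] with [i < 2 ^ n]. *)
  have /andP[lo hi] := @trunc_log_bounds 2 m isT m1.
  have /flipsP/(_ (m - 2 ^ trunc_log 2 m)%N) := fn (trunc_log 2 m).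
  by rewrite subnK //; apply; rewrite ltn_subLR // addnn -mul2n -expnS.
split=> [on|[g0 bm bn]].
  have fn n : flips g n by apply: odometer_flips.
  have /defect_vanishP[g0 bn] : forall n, res (defect n) n.+1 = 0%N.
    by move=> n; apply/eq_res_sub/odometerSP.
  by split=> //; apply/oddP.
have /oddP fn := bm.
have d : forall n, res (defect n) n.+1 = 0%N by apply/defect_vanishP.
elim=> [|n ih]; first exact: odometer0.
by apply/odometerSP => //; apply/eq_res_sub/d.
Qed.

End coefficients.

(** * Measurability and uniqueness of measures via cylinders *)

Lemma measurable_cyl n j : measurable (cyl n j).
Proof.
by rewrite measurable_cyls; apply: sub_sigma_algebra; right; exists n, j.
Qed.

Lemma measurable_res_saturated n (A : set z2) :
  (forall x y, res x n = res y n -> A x -> A y) -> measurable A.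
Proof.
move=> An; have -> : A = \bigcup_(j in [set res x n | x in A]) cyl n j.
  apply/seteqP; split=> [x Ax|x [_ [y Ay <-] xy]].
    by exists (res x n) => //; exists x.
  exact: An Ay.
by apply: bigcup_measurable => j _; exact: measurable_cyl.
Qed.

Lemma measurable_res_compat (f : z2 -> z2) :
  (forall n x y, res x n = res y n -> res (f x) n = res (f y) n) ->
  measurable_fun setT f.
Proof.
move=> f_res; apply: (measurability _ measurable_cyls) => _ [B [->|[n [j ->]]] <-].
  by rewrite preimage_set0 setI0.
rewrite setTI; apply: (@measurable_res_saturated n) => x y xy.
by rewrite /cyl /= (f_res n x y).
Qed.

Lemma lipschitz1_res f n x y : lipschitz1 f ->
  res x n = res y n -> res (f x) n = res (f y) n.
Proof.
move=> f_lip /eq_res_sub xy; apply/eq_res_sub/eqP.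
by rewrite -abs2_le; apply: le_trans (f_lip x y) _; rewrite abs2_le xy.
Qed.

(** With the empty set, the cylinders form a generating family closed under intersection. *)
Lemma measure_unique_cyl (R : realType) (m1 m2 : {measure set z2 -> \bar R}) :
  (forall n j, m1 (cyl n j) = m2 (cyl n j)) -> (m1 setT < +oo)%E ->
  forall A, measurable A -> m1 A = m2 A.
Proof.
move=> m12 m1oo A mA.
apply: (@measure_unique _ R _ cyls (fun=> cyl 0 0)) => //.
- exact: measurable_cyls.
- exact: setI_closed_cyls.
- by move=> _; right; exists 0%N, 0%N.
- by apply/seteqP; split => // z _; exists 0%N => //; exact: res_at0.
- by move=> _ [->|[n [j ->]]]; rewrite ?measure0.
- move=> _; apply: le_lt_trans m1oo; apply: le_measure; rewrite ?inE //.
  exact: measurable_cyl.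
Qed.

(** * Subdivision of a cylinder *)

Section subcylinders.
Variables (q c : nat).
Hypothesis c_lt : (c < 2 ^ q)%N.

(** For [i < 2 ^ n], the image of [cyl n i] under [t |-> c + 2 ^ q * t]. *)
Definition subcyl n i := cyl (q + n) (c + 2 ^ q * i).

Lemma measurable_subcyl n i : measurable (subcyl n i).
Proof. exact: measurable_cyl. Qed.

Lemma in_cylP z : cyl q c z <-> exists t, z = c%:R + 2 ^+ q * t.
Proof.
have resc : res c%:R q = c by rewrite res_natr modn_small.
split=> [zc|[t ->]].
  have /eq_res_dvdP[t tE] : res (z - c%:R) q = 0%N by apply/eq_res_sub; rewrite resc.
  by exists t; rewrite -tE addrC subrK.
apply: etrans resc; apply/eq_res_addl0.
by rewrite resM res_expn mul0n mod0n.
Qed.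

Lemma in_subcyl n i t : (i < 2 ^ n)%N ->
  subcyl n i (c%:R + 2 ^+ q * t) <-> res t n = i.
Proof.
move=> lti; have resi : res i%:R n = i by rewrite res_natr modn_small.
have -> : subcyl n i = [set z | res z (q + n) = res (c%:R + 2 ^+ q * i%:R) (q + n)].
  rewrite -natrX -natrM -natrD res_natr modn_small // expnD.
  by rewrite (@leq_trans (2 ^ q * i.+1)) ?leq_mul // mulnS ltn_add2r.
by rewrite /mkset ![c%:R + _]addrC eq_res_addr res_mulX2 resi.
Qed.

Lemma subcyl_sub n i : subcyl n i `<=` cyl q c.
Proof.
move=> z; rewrite /subcyl /cyl /= => zi.
by rewrite -(res_leq_mod z (leq_addr n q)) zi addnC mulnC modnMDl modn_small.
Qed.

Lemma cyl_split n :
  cyl q c = \big[setU/set0]_(i < 2 ^ n) subcyl n i.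
Proof.
rewrite -bigcup_mkord; apply/seteqP; split=> [z /in_cylP[t ->]|z [i _]].
  by exists (res t n); [|apply/in_subcyl]; rewrite /= ?res_lt.
exact: subcyl_sub.
Qed.

Lemma trivIset_subcyl n (D : set 'I_(2 ^ n)) (B : set z2) :
  trivIset D (fun i => subcyl n i `&` B).
Proof.
move=> i j _ _ [z [[zi _] [zj _]]].
have /in_cylP[t tE] := subcyl_sub zi.
by apply: val_inj => /=; move: zi zj; rewrite tE !in_subcyl // => -> ->.
Qed.

Lemma measure_cyl_split (R : realType) (nu : {measure set z2 -> \bar R}) n B :
  measurable B ->
  nu (cyl q c `&` B) = (\sum_(i < 2 ^ n) nu (subcyl n i `&` B))%E.
Proof.
move=> mB; rewrite (cyl_split n) big_distrl /= measure_semi_additive_ord //.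
- by move=> i; apply: measurableI => //; exact: measurable_subcyl.
- exact: trivIset_subcyl.
- apply: bigsetU_measurable => i _; apply: measurableI => //.
  exact: measurable_subcyl.
Qed.

End subcylinders.

(** * Haar measure of cylinders *)

Section haar_cylinders.
Context (R : realType) (mu : probability z2 R).
Hypothesis mu_haar : translation_invariant mu.

Lemma haar_cyl_eq n j k : (j < 2 ^ n)%N -> (k < 2 ^ n)%N ->
  mu (cyl n j) = mu (cyl n k).
Proof.
have trans0 i : (i < 2 ^ n)%N -> mu (cyl n i) = mu (cyl n 0).
  move=> lti; rewrite -(mu_haar i%:R (measurable_cyl n 0)); congr (mu _).
  have resi : res i%:R n = i by rewrite res_natr modn_small.
  apply/seteqP; split=> [x xi|_ [x x0 <-]].
    exists (x - i%:R); last by rewrite addrC subrK.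
    by apply/eq_res_sub; rewrite resi.
  by apply: etrans resi; exact/eq_res_addl0.
by move=> ltj ltk; rewrite !trans0.
Qed.

(** A null cylinder would make all its [2 ^ n] translates null, and with them the whole space. *)
Lemma haar_cyl_gt0 n j : (j < 2 ^ n)%N -> (0 < mu (cyl n j))%E.
Proof.
move=> ltj; rewrite lt0e measure_ge0 andbT; apply/eqP => j0.
have /eqP := @probability_setT _ _ _ mu.
have -> : [set: z2] = cyl 0 0 `&` setT.
  by rewrite setIT; apply/seteqP; split=> // z _; exact: res_at0.
rewrite (measure_cyl_split (isT : (0 < 2 ^ 0)%N) mu n) // big1 => [|i _].
  by rewrite eq_sym onee_eq0.
rewrite setIT /subcyl !add0n expn0 mul1n; apply: etrans j0.
exact: haar_cyl_eq.
Qed.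

End haar_cylinders.

(** * Ergodicity on the cylinder is equivalent to single cycles at every level *)

Section sphere_dynamics.
Context (R : realType) (mu : probability z2 R).
Hypothesis mu_haar : translation_invariant mu.
Variables (q c : nat) (f g : z2 -> z2).
Hypothesis c_lt : (c < 2 ^ q)%N.
Hypothesis f_res : forall n x y, res x n = res y n -> res (f x) n = res (f y) n.
Hypothesis fg : forall t, f (c%:R + 2 ^+ q * t) = c%:R + 2 ^+ q * g t.

Let S := cyl q c.
Let C n (i : 'I_(2 ^ n)) := subcyl q c n i.
Let mS : measurable S := measurable_cyl q c.
Let mC n i : measurable (@C n i) := measurable_subcyl q c n i.

Lemma conjugate_res n x y : res x n = res y n -> res (g x) n = res (g y) n.
Proof.
move=> xy; apply/(res_mulX2 q); apply/(eq_res_addr _ _ _ c%:R).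
rewrite ![_ + c%:R]addrC -!fg; apply: f_res.
by rewrite ![c%:R + _]addrC; apply/eq_res_addr/res_mulX2.
Qed.

(** The map induced by [g] on residues; it records which subcylinder [f] sends each subcylinder
    into. *)
Definition step n (i : 'I_(2 ^ n)) := Ordinal (res_lt (g i%:R) n).

Lemma subcyl_mapsto n i z : @C n i z -> C (step i) (f z).
Proof.
move=> zi; have /in_cylP[//|t tE] := subcyl_sub c_lt zi.
move: zi; rewrite /C tE fg !in_subcyl ?res_lt // => ti; apply: conjugate_res.
by rewrite ti res_natr modn_small.
Qed.

Lemma cyl_sub_subcyl n z : S z -> exists i, @C n i z.
Proof.
move=> /(in_cylP c_lt)[t ->]; exists (Ordinal (res_lt t n)).
by apply/in_subcyl => //; exact: res_lt.
Qed.

Lemma subcyl_inj n (i j : 'I_(2 ^ n)) z : C i z -> C j z -> i = j.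
Proof.
move=> zi zj; apply: (@trivIset_subcyl _ _ c_lt n setT setT) => //.
by exists z.
Qed.

Lemma subcyl_base n i : @C n i (c%:R + 2 ^+ q * i%:R).
Proof. by apply/in_subcyl => //; rewrite res_natr modn_small. Qed.

Lemma image_cyl_sub : f @` S `<=` S.
Proof.
by move=> _ [z /(in_cylP c_lt)[t ->] <-]; rewrite fg; apply/in_cylP => //; exists (g t).
Qed.

Lemma preimage_subcyl n (i : 'I_(2 ^ n)) : injective (@step n) ->
  S `&` f @^-1` C (step i) = C i.
Proof.
move=> sI; apply/seteqP; split=> [z [/(cyl_sub_subcyl n)[j zj] fz]|z zi].
  by rewrite -(sI _ _ (subcyl_inj (subcyl_mapsto zj) fz)).
by split; [exact: subcyl_sub zi | exact: subcyl_mapsto].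
Qed.

Lemma subcyl_lt n (i : 'I_(2 ^ n)) : (c + 2 ^ q * i < 2 ^ (q + n))%N.
Proof.
rewrite expnD (@leq_trans (2 ^ q * i.+1)) ?leq_mul //.
by rewrite mulnS ltn_add2r.
Qed.

Lemma haar_subcyl_eq n i j : mu (@C n i) = mu (@C n j).
Proof. by apply: haar_cyl_eq => //; exact: subcyl_lt. Qed.

Lemma haar_subcyl_gt0 n i : (0 < mu (@C n i))%E.
Proof. by apply: haar_cyl_gt0 => //; exact: subcyl_lt. Qed.

Lemma mu_S_gt0 : (0 < mu S)%E.
Proof. exact: haar_cyl_gt0. Qed.

Lemma mu_fin_num A : measurable A -> mu A \is a fin_num.
Proof. exact: fin_num_measure. Qed.

Lemma step_iter n k (i : 'I_(2 ^ n)) : val i = 0%N ->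
  val (iter k (@step n) i) = res (iter k g 0) n.
Proof.
move=> i0; elim: k => [|k ih]; first by rewrite res0.
by rewrite !iterS /= ih; apply: conjugate_res; rewrite res_natr res_mod.
Qed.

Let zero_ord n : 'I_(2 ^ n) := Ordinal (res_lt 0 n).
Let val_zero_ord n : val (zero_ord n) = 0%N. Proof. exact: res0. Qed.

Lemma odometer_step_inj n : odometer g n -> injective (@step n).
Proof.
move=> on i j /(congr1 val) /= gij; apply: val_inj.
have [k _ ki] := odometer_surj on (ltn_ord i).
have [l _ lj] := odometer_surj on (ltn_ord j).
rewrite /= -ki -lj; apply/on.
have /on/eqP : res (iter k.+1 g 0) n = res (iter l.+1 g 0) n.
  have -> : res (iter k.+1 g 0) n = res (g i%:R) n.
    by apply: conjugate_res; rewrite ki res_natr modn_small.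
  by rewrite gij; apply: conjugate_res; rewrite lj res_natr modn_small.
by rewrite -(addn1 k) -(addn1 l) eqn_modDr => /eqP.
Qed.

(** Conversely, transitivity makes the orbit of [0] fill all [2 ^ n] residues, so its period is
    [2 ^ n], and [findex] recovers the exponent modulo the period. *)
Lemma odometerE n : odometer g n <->
  injective (@step n) /\ forall i, fconnect (@step n) (zero_ord n) i.
Proof.
split=> [on|[sI sT]].
  split; first exact: odometer_step_inj.
  move=> i; have [k _ ki] := odometer_surj on (ltn_ord i).
  suff -> : i = iter k (@step n) (zero_ord n) by exact: fconnect_iter.
  by apply: val_inj; rewrite step_iter.
have ordE : order (@step n) (zero_ord n) = (2 ^ n)%N.
  by rewrite /order -[RHS]card_ord; apply: eq_card => i; rewrite inE sT.
have iter_mod k :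
    iter k (@step n) (zero_ord n) = iter (k %% 2 ^ n) (@step n) (zero_ord n).
  rewrite {1}(divn_eq k (2 ^ n)) addnC iterD; congr (iter _ _ _).
  have := iter_order sI (zero_ord n); rewrite ordE => period.
  by elim: (k %/ _)%N => // j ih; rewrite mulSn addnC iterD period.
move=> k l; rewrite -!(step_iter _ (val_zero_ord n)).
split=> [/val_inj|kl]; rewrite iter_mod [in RHS]iter_mod ?kl //.
move=> /(congr1 (findex (@step n) (zero_ord n))).
by rewrite !findex_iter // ordE ltn_mod expn_gt0.
Qed.

Lemma normalized_restrE A : measurable A -> A `<=` S ->
  normalized_restr mu S A = fine (mu A) / fine (mu S).
Proof. by move=> mA AS; rewrite /normalized_restr (setIidl AS). Qed.

Lemma fine_mu_S_gt0 : 0 < fine (mu S).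
Proof.
by rewrite fine_gt0 // mu_S_gt0 ltey_eq mu_fin_num.
Qed.

Lemma fine_mu_S_neq0 : fine (mu S) != 0.
Proof. by rewrite gt_eqF ?fine_mu_S_gt0. Qed.

Lemma normalized_restr_eq A B : measurable A -> measurable B ->
  A `<=` S -> B `<=` S ->
  normalized_restr mu S A = normalized_restr mu S B <-> mu A = mu B.
Proof.
move=> mA mB AS BS; rewrite !normalized_restrE //; split=> [/eqP|-> //].
rewrite (inj_eq (mulIf _)) ?invr_eq0 ?fine_mu_S_neq0 // => /eqP AB.
by rewrite -(fineK (mu_fin_num mA)) AB fineK ?mu_fin_num.
Qed.

(** Preimages of subcylinders have positive measure, so [step] is onto, hence injective. If its
    orbit of [0] missed some [j], the subcylinders on that orbit would form an invariant set of
    intermediate measure. *)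
Lemma ergodic_odometer : ergodic_on mu S f -> forall n, odometer g n.
Proof.
move=> [_ pres erg] n; apply/odometerE.
have CS i : @C n i `<=` S by exact: subcyl_sub.
have sI : injective (@step n).
  have hitP j : exists i, step i = j :> 'I_(2 ^ n).
    have [mp pj] := pres _ (mC j) (CS j).
    have muj : mu (S `&` f @^-1` C j) = mu (C j).
      by apply/normalized_restr_eq => //; exact: subIsetl.
    have [z [Sz fz]] : (S `&` f @^-1` C j) !=set0.
      apply/set0P/eqP => p0; have := haar_subcyl_gt0 j.
      by rewrite -muj p0 measure0 ltxx.
    have [i zi] := cyl_sub_subcyl n Sz; exists i.
    exact: subcyl_inj (subcyl_mapsto zi) fz.
  have [h hK] := choice hitP.
  have [k kh hk] := injF_bij (can_inj hK).
  by move=> i j; rewrite -(hk i) -(hk j) !hK => ->.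
split=> // j; apply: contrapT => /negP nj.
pose E := \bigcup_(i in [set i | fconnect (@step n) (zero_ord n) i]) C i.
have mE : measurable E.
  apply: (@measurable_res_saturated (q + n)) => x y xy [i i0 xi]; exists i => //.
  by move: xi; rewrite /C /subcyl /cyl /= xy.
have ES : E `<=` S by move=> z [i _ /CS].
(* Equality with the full preimage needs orbits closed under predecessors too, whence the
   injectivity of [step]. *)
have Einv : S `&` f @^-1` E = E.
  apply/seteqP; split=> [z [/(cyl_sub_subcyl n)[i zi] [k k0 fz]]|z [i i0 zi]].
    exists i => //=; rewrite (same_fconnect1_r sI).
    by rewrite (subcyl_inj (subcyl_mapsto zi) fz).
  split; first exact: CS zi.
  by exists (step i); [rewrite /= -(same_fconnect1_r sI) | exact: subcyl_mapsto].
have mu_mono A B : measurable A -> measurable B -> A `<=` B -> (mu A <= mu B)%E.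
  by move=> mA mB AB; apply: le_measure; rewrite ?inE.
case: (erg E mE ES Einv).
  rewrite normalized_restrE // => /eqP.
  rewrite mulf_eq0 invr_eq0 (negPf fine_mu_S_neq0) orbF => /eqP E0.
  have : (mu (C (zero_ord n)) <= mu E)%E.
    by apply: mu_mono => // z z0; exists (zero_ord n) => //=; exact: connect0.
  by rewrite -(fineK (mu_fin_num mE)) E0 leNgt haar_subcyl_gt0.
rewrite normalized_restrE // => /eqP.
rewrite eq_sym -(divff fine_mu_S_neq0).
rewrite (inj_eq (mulIf _)) ?invr_eq0 ?fine_mu_S_neq0 // => /eqP SE.
have EC : E `&` C j = set0.
  apply/seteqP; split=> // z [[i i0 zi] zj]; case/negP: nj.
  by rewrite -(subcyl_inj zi zj).
have : (mu (E `|` C j) <= mu S)%E.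
  by apply: mu_mono; [exact: measurableU | | rewrite subUset].
rewrite measureU // -(fineK (mu_fin_num mS)) SE fineK ?mu_fin_num //.
by rewrite leNgt lteDl ?mu_fin_num // haar_subcyl_gt0.
Qed.

Lemma subcyl_res n (i : 'I_(2 ^ n)) z : C i z -> res z n = res (c%:R + 2 ^+ q * i%:R) n.
Proof.
move=> zi; apply: (@cyl_le _ _ (q + n)); first exact: leq_addl.
by rewrite (zi : res z _ = _) (subcyl_base i : res _ _ = _).
Qed.

(** A subcylinder fixes [q + n] digits, so a cylinder of level [n] contains it or misses it. *)
Lemma subcyl_cyl n j (i : 'I_(2 ^ n)) (B : set z2) : C i `&` (B `&` cyl n j) =
  if res (c%:R + 2 ^+ q * i%:R) n == j then C i `&` B else set0.
Proof.
case: ifP => [/eqP ij|/eqP nij].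
  apply/seteqP; split=> z [zi]; first by case.
  by move=> Bz; do 2?split=> //; rewrite /cyl /mkset (subcyl_res zi).
by apply/seteqP; split=> // z [zi [_ zj]]; apply: nij; rewrite -(subcyl_res zi).
Qed.

(** The count is the same for every [B], so two equidistributed sets have proportional measures on
    cylinders. *)
Lemma mu_equidistributed n j (B : set z2) (x : R) : measurable B ->
  (forall i : 'I_(2 ^ n), mu (C i `&` B) = x%:E) ->
  mu (S `&` B) = (x *+ 2 ^ n)%:E /\
  mu (S `&` (B `&` cyl n j)) =
    (x *+ #|[pred i : 'I_(2 ^ n) | res (c%:R + 2 ^+ q * i%:R) n == j]|)%:E.
Proof.
move=> mB Bx; split.
  rewrite (measure_cyl_split c_lt mu n) //.
  rewrite (eq_bigr (fun=> x%:E)) => [|i _]; last exact: Bx.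
  by rewrite sumEFin sumr_const card_ord.
rewrite (measure_cyl_split c_lt mu n); last first.
  by apply: measurableI => //; exact: measurable_cyl.
rewrite -sumr_const -sumEFin [RHS]big_mkcond; apply: eq_bigr => i _.
rewrite (subcyl_cyl j i B) inE.
by case: ifP => _; [exact: Bx | exact: measure0].
Qed.

(** An invariant [E] has equal mass in all subcylinders of a level, which makes it independent of
    every Borel set for the normalized measure, in particular of itself. *)
Lemma odometer_ergodic : (forall n, odometer g n) -> ergodic_on mu S f.
Proof.
move=> on; have mf := measurable_res_compat f_res.
have mfpre A : measurable A -> measurable (f @^-1` A).
  by move=> mA; rewrite -[X in measurable X]setTI; exact: mf.
have mpre A : measurable A -> measurable (S `&` f @^-1` A).
  by move=> /mfpre; exact: measurableI.
have sI n : injective (@step n) by exact: odometer_step_inj.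
pose fM : {mfun z2 >-> z2} := mfun_Sub (mem_set mf).
have invariant A : measurable A -> mu (S `&` f @^-1` A) = mu (S `&` A).
  move=> mA; pose m1 := pushforward (mrestr mu mS) fM; pose m2 := mrestr mu mS.
  suff : m1 A = m2 A by rewrite /m1 /m2 /pushforward /mrestr ![_ `&` S]setIC.
  apply: measure_unique_cyl => // [n j|]; last first.
    change (mu (f @^-1` setT `&` S) < +oo)%E.
    by rewrite preimage_setT setTI ltey_eq mu_fin_num.
  change (mu (f @^-1` cyl n j `&` S) = mu (cyl n j `&` S)).
  rewrite ![_ `&` S]setIC.
  have mc := measurable_cyl n j; have mfc := mfpre _ mc.
  rewrite !(measure_cyl_split c_lt mu n) //.
  (* Reindexed by the permutation [step], both sums have terms that are full or empty under the same
     test, and full subcylinders have equal measure. *)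
  rewrite [RHS](reindex_inj (sI n)); apply: eq_bigr => i _.
  rewrite -(setTI (cyl n j)) (subcyl_cyl j (step i) setT) setIT.
  have -> : C i `&` f @^-1` (setT `&` cyl n j) =
      if res (c%:R + 2 ^+ q * (step i)%:R) n == j then C i else set0.
    rewrite setTI; case: ifP => [/eqP ij|/eqP nij].
      apply: setIidl => z zi; rewrite /cyl /preimage /mkset.
      by rewrite (subcyl_res (subcyl_mapsto zi)).
    apply/seteqP; split=> // z [zi zj]; apply: nij.
    by rewrite -(subcyl_res (subcyl_mapsto zi)).
  by case: ifP => // _; exact: haar_subcyl_eq.
have CS n i : @C n i `<=` S by exact: subcyl_sub.
split; first exact: image_cyl_sub.
  move=> E mE ES; split; first exact: mpre.
  apply/normalized_restr_eq => //; first exact: mpre.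
  by rewrite invariant // (setIidr ES).
move=> E mE ES Einv.
have mu_EC n (i : 'I_(2 ^ n)) : mu (C i `&` E) = mu (C (zero_ord n) `&` E).
  have [_ /(_ i)/iter_findex <-] := (odometerE n).1 (on n).
  elim: (findex _ _ _) => // k <-; rewrite iterS; set j := iter k _ _.
  (* The part of [E] in [C (step j)] pulls back to its part in [C j], so invariance of [mu] carries
     the mass along the cycle. *)
  have mCE : measurable (C (step j) `&` E) by exact: measurableI.
  have CES : C (step j) `&` E `<=` S by move=> z [_ /ES].
  rewrite -[in LHS](setIidr CES) -invariant //.
  rewrite preimage_setI setIA preimage_subcyl // -[in RHS]Einv setIA.
  by rewrite (setIidl (CS _ _)).
have product A : measurable A ->
    (mu (E `&` A) * mu S = mu E * mu (S `&` A))%E.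
  move=> mA; have fS := fineK (mu_fin_num mS); have fE := fineK (mu_fin_num mE).
  have S0 : 0 <= fine (mu S) by exact: fine_ge0.
  have E0 : 0 <= fine (mu E) by exact: fine_ge0.
  pose m1 := mscale (NngNum S0) (mrestr mu mE).
  pose m2 := mscale (NngNum E0) (mrestr mu mS).
  suff : m1 A = m2 A.
    change ((fine (mu S))%:E * mu (A `&` E) = (fine (mu E))%:E * mu (A `&` S) ->
      mu (E `&` A) * mu S = mu E * mu (S `&` A))%E.
    by rewrite fS fE muleC ![A `&` _]setIC.
  apply: measure_unique_cyl => // [n j|]; last first.
    change ((fine (mu S))%:E * mu (setT `&` E) < +oo)%E.
    by rewrite setTI ltey_eq fin_numM // mu_fin_num.
  change ((fine (mu S))%:E * mu (cyl n j `&` E) =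
          (fine (mu E))%:E * mu (cyl n j `&` S))%E.
  rewrite ![cyl n j `&` _]setIC.
  have fC := fineK (mu_fin_num (measurableI _ _ (mC (zero_ord n)) mE)).
  have ECx := mu_EC n; rewrite -fC in ECx.
  have TCx (i : 'I_(2 ^ n)) : mu (C i `&` setT) = (fine (mu (C (zero_ord n))))%:E.
    by rewrite setIT fineK ?mu_fin_num //; exact: haar_subcyl_eq.
  have [SE SEj] := mu_equidistributed j mE ECx.
  have [ST STj] := mu_equidistributed j measurableT TCx.
  rewrite setTI in STj; rewrite setIT in ST; rewrite (setIidr ES) in SE.
  rewrite setIA (setIidr ES) in SEj.
  rewrite SEj STj ST SE /= -!EFinM; congr (_%:E).
  by rewrite !mulrnAl !mulrnAr [in RHS]mulrC.
(* With [A = E] this is [mu E * mu S = mu E * mu E]. *)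
have /eqP := product E mE; rewrite setIid (setIidr ES).
rewrite -(fineK (mu_fin_num mS)) -(fineK (mu_fin_num mE)) -!EFinM eqe.
rewrite -subr_eq0 -mulrBr mulf_eq0 subr_eq0 => /orP[]/eqP E0.
  by left; rewrite normalized_restrE // E0 mul0r.
by right; rewrite normalized_restrE // -E0 divff // fine_mu_S_neq0.
Qed.

End sphere_dynamics.

(** * Van der Put series at natural numbers *)

Lemma vdp_chi_nat k m : vdp_chi k m%:R =
  if (m == k %[mod 2 ^ (trunc_log 2 k).+1])%N then 1 else 0.
Proof.
rewrite /vdp_chi; congr (if _ then _ else _).
by apply/asboolP/eqP; rewrite z2_congrP !res_natr.
Qed.

Lemma ltn_expn_trunc_log k : (k < 2 ^ (trunc_log 2 k).+1)%N.
Proof. by case: k => // k; have /andP[] := @trunc_log_bounds 2 k.+1 isT isT. Qed.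

Lemma vdp_chi_gt k m : (m < k)%N -> vdp_chi k m%:R = 0.
Proof.
move=> mk; have kL := ltn_expn_trunc_log k.
by rewrite vdp_chi_nat !modn_small ?ltn_eqF // (ltn_trans mk).
Qed.

(** Terms of index above [m] vanish at [m], so the partial sums are eventually constant. *)
Lemma vdp_series_nat (f : z2 -> z2) (b : nat -> z2) m N : has_vdp_series f b ->
  (m < N)%N -> f m%:R = vdp_series b m%:R N.
Proof.
move=> f_vdp mN; have := f_vdp m%:R.
suff : vdp_series b m%:R @ \oo --> vdp_series b m%:R N.
  by move=> h1 h2; exact: (cvg_unique (@metric_hausdorff _ _) h2 h1).
apply: cvg_near_cst; exists N => // n /= Nn.
rewrite /vdp_series (big_cat_nat (leq0n N) Nn) /= [X in _ + X]big_nat_cond.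
rewrite [X in _ + X]big1 ?addr0 // => k /andP[/andP[Nk _] _].
by rewrite vdp_chi_gt ?mulr0 // (leq_trans mN).
Qed.

(** Terms of index below [2 ^ K] agree at [i] and [i + 2 ^ K], those from [2 ^ K] up to before
    [i + 2 ^ K] vanish at the latter, and only the last one is new. *)
Lemma vdp_coefficient (f : z2 -> z2) (b : nat -> z2) K i : has_vdp_series f b ->
  (0 < K)%N -> (i < 2 ^ K)%N ->
  f (i + 2 ^ K)%:R = f i%:R + 2 ^+ K * b (i + 2 ^ K)%N.
Proof.
move=> f_vdp K0 iK; set m := (i + 2 ^ K)%N.
have mK : (m < 2 ^ K.+1)%N by rewrite /m expnS mul2n -addnn ltn_add2r.
have logK k : (2 ^ K <= k <= m)%N -> trunc_log 2 k = K.
  move=> /andP[Kk km]; apply: trunc_log_eq => //.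
  by rewrite Kk (leq_ltn_trans km).
have Km : (2 ^ K <= m)%N by exact: leq_addl.
rewrite (vdp_series_nat f_vdp (ltnSn m)) (vdp_series_nat f_vdp iK) /vdp_series.
rewrite big_nat_recr // (big_cat_nat (leq0n _) Km) /= logK ?Km ?leqnn //.
rewrite vdp_chi_nat eqxx mulr1; congr (_ + _).
rewrite [X in _ + X]big_nat_cond [X in _ + X]big1 ?addr0 => [|k].
  apply: eq_big_nat => k /andP[_ kK]; congr (_ * _).
  rewrite !vdp_chi_nat; congr (if _ then _ else _).
  have logk : (trunc_log 2 k < K)%N.
    (* At [k = 0] the modulus is 2, and it divides [2 ^ K] because [K] is positive. *)
    case: k kK => [|k] kK; first by rewrite trunc_log0.
    have /andP[lo _] := @trunc_log_bounds 2 k.+1 isT isT.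
    by rewrite -(@ltn_exp2l 2) // (leq_ltn_trans lo).
  rewrite /m -modnDmr (_ : 2 ^ K %% _ = 0)%N ?addn0 //.
  by apply/eqP; rewrite -/(dvdn _ _) dvdn_exp2l.
move=> /andP[/andP[Kk km] _].
have lk : trunc_log 2 k = K by apply: logK; rewrite Kk (ltnW km).
rewrite vdp_chi_nat lk (modn_small mK) (modn_small (ltn_trans km mK)).
by rewrite (gtn_eqF km) mulr0.
Qed.

(** * The sphere as a cylinder, and the conditions on it *)

Lemma sphere2_cyl r a : (a < 2 ^ r)%N ->
  sphere2 r a%:R = cyl (r + 1) (a + 2 ^ r).
Proof.
move=> ar; have c_lt : (a + 2 ^ r < 2 ^ r.+1)%N.
  by rewrite expnS mul2n -addnn ltn_add2r.
have resc : res (a%:R + 2 ^+ r) r.+1 = (a + 2 ^ r)%N.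
  by rewrite -natrX -natrD res_natr modn_small.
rewrite addn1; apply/seteqP; split=> z.
  move=> /abs2_eqP[z0 z1].
  have /flip_res : res (z - a%:R) r = res 0 r by rewrite res0.
  rewrite res0 add0r => -[E|E]; first by rewrite E in z1.
  apply: etrans resc; rewrite -[z](subrK a%:R) [a%:R + _]addrC.
  exact/eq_res_addr.
move=> zc; have E : res (z - a%:R) r.+1 = res (2 ^+ r) r.+1.
  apply/(eq_res_addr _ _ _ a%:R); rewrite subrK addrC resc; exact: zc.
apply/abs2_eqP; rewrite E; split.
  by rewrite (cyl_le (leqnSn r) E) res_expn.
by rewrite -natrX res_natr modn_small ?ltn_exp2l // expn_eq0.
Qed.

Lemma z2_congr4P x y : z2_congr 4 x y <-> res x 2 = res y 2.
Proof. by rewrite -z2_congrP -natrX. Qed.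

(** Subtracting [a + 2 ^ r] and dividing by [2 ^ (r + 1)] turns the first condition into oddness of
    [g 0]. The block conditions split into three because [2 ^ n] modulo 4 is 1, 2, then 0. *)
Lemma vdp_conditionsP r a (f g : z2 -> z2) (b : nat -> z2) :
  f (a + 2 ^ r)%:R = (a + 2 ^ r)%:R + 2 ^+ (r + 1) * g 0 ->
  let b' m := b (a + 2 ^ r + m * 2 ^ (r + 1))%N in
  [/\ res (g 0) 1 = 1%N, forall m, (1 <= m)%N -> res (b' m) 1 = 1%N &
      forall n, res (block b' n) 2 = res (2 ^+ n) 2] <->
  [/\ z2_congr (2 ^+ (r + 2)) (f (a + 2 ^ r)%:R) (a + 2 ^ r + 2 ^ (r + 1))%:R,
      forall m : nat, (1 <= m)%N -> abs2 (b (a + 2 ^ r + m * 2 ^ (r + 1))%N) = 1,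
      z2_congr 4 (b (a + 2 ^ r + 2 ^ (r + 1))%N) 1,
      z2_congr 4 (b (a + 2 ^ r + 2 ^ (r + 2))%N
                  + b (a + 2 ^ r + 3 * 2 ^ (r + 1))%N) 2 &
      forall n : nat, (3 <= n)%N ->
        z2_congr 4
          (\sum_(2 ^ (n - 1) <= m < 2 ^ n) b (a + 2 ^ r + m * 2 ^ (r + 1))%N) 0].
Proof.
move=> fc b'.
have c1 : z2_congr (2 ^+ (r + 2)) (f (a + 2 ^ r)%:R) (a + 2 ^ r + 2 ^ (r + 1))%:R <->
    res (g 0) 1 = 1%N.
  rewrite z2_congrP fc [(_ + 2 ^ (r + 1))%:R]natrD natrX.
  rewrite ![(a + 2 ^ r)%:R + _]addrC eq_res_addr (addnA r 1 1).
  by have := res_mulX2 (r + 1) 1 (g 0) 1; rewrite mulr1.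
have block0 : block b' 0 = b (a + 2 ^ r + 2 ^ (r + 1))%N.
  by rewrite /block big_nat1 /b' mul1n.
have block1 : block b' 1 = b (a + 2 ^ r + 2 ^ (r + 2))%N
                  + b (a + 2 ^ r + 3 * 2 ^ (r + 1))%N.
  by rewrite /block big_ltn // big_nat1 /b' -expnD addnCA.
have blockn n : (3 <= n)%N -> block b' n.-1 =
    \sum_(2 ^ (n - 1) <= m < 2 ^ n) b (a + 2 ^ r + m * 2 ^ (r + 1))%N.
  by case: n => // n _; rewrite /block subn1.
have res4 n : res (2 ^+ n.+2) 2 = 0%N.
  by rewrite -(addn2 n) exprD resM res_expn muln0 mod0n.
split=> [[g0 odd_b bn]|[/c1 g0 odd_b b0 b1 bn]].
  split; first exact/c1.
  - by move=> m m1; apply/abs2_eq1P/odd_b.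
  - by apply/z2_congr4P; rewrite -block0 bn.
  - by apply/z2_congr4P; rewrite -block1 bn.
  - move=> n n3; apply/z2_congr4P; rewrite -blockn // bn.
    by case: n n3 => [|[|[|n]]] // _; rewrite res4 res0.
split=> // [m m1|[|[|n]]]; first exact/abs2_eq1P/odd_b.
- by rewrite block0; apply/z2_congr4P.
- by rewrite block1; apply/z2_congr4P.
- by rewrite res4 -(res0 2) -[n.+2]/(n.+3.-1) blockn //; apply/z2_congr4P/bn.
Qed.

(** * Ergodicity on the sphere and the van der Put coefficients *)

Theorem theorem3p1 (R : realType) (mu : probability z2 R)
    (mu_haar : translation_invariant mu)
    (r a : nat) (r_ge1 : (1 <= r)%N) (a_lt : (a < 2 ^ r)%N)
    (f : z2 -> z2) (f_lip : lipschitz1 f)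
    (b : nat -> z2) (f_vdp : has_vdp_series f b) :
  ergodic_on mu (sphere2 r a%:R) f <->
  [/\ z2_congr (2 ^+ (r + 2)) (f (a + 2 ^ r)%:R) (a + 2 ^ r + 2 ^ (r + 1))%:R,
      forall m : nat, (1 <= m)%N -> abs2 (b (a + 2 ^ r + m * 2 ^ (r + 1))%N) = 1,
      z2_congr 4 (b (a + 2 ^ r + 2 ^ (r + 1))%N) 1,
      z2_congr 4 (b (a + 2 ^ r + 2 ^ (r + 2))%N
                  + b (a + 2 ^ r + 3 * 2 ^ (r + 1))%N) 2 &
      forall n : nat, (3 <= n)%N ->
        z2_congr 4
          (\sum_(2 ^ (n - 1) <= m < 2 ^ n) b (a + 2 ^ r + m * 2 ^ (r + 1))%N) 0].
Proof.
have f_res n x y : res x n = res y n -> res (f x) n = res (f y) n.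
  exact: lipschitz1_res.
set q := (r + 1)%N; set c := (a + 2 ^ r)%N.
have c_lt : (c < 2 ^ q)%N by rewrite /q addn1 expnS mul2n -addnn ltn_add2r.
have resc : res c%:R q = c by rewrite res_natr modn_small.
pose b' m := b (c + m * 2 ^ q)%N.
(* That [f] keeps the centre [c] in the sphere suffices: [f] respects residues modulo [2 ^ q], so
   the whole sphere is mapped into itself. *)
have conj_g : res (f c%:R) q = c -> exists2 g : z2 -> z2,
    (forall t, f (c%:R + 2 ^+ q * t) = c%:R + 2 ^+ q * g t) &
    forall n i, (i < 2 ^ n)%N ->
      g (i + 2 ^ n)%:R = g i%:R + 2 ^+ n * b' (i + 2 ^ n)%N.
  move=> fc; have /choice[g fg] t :
      exists s, f (c%:R + 2 ^+ q * t) = c%:R + 2 ^+ q * s.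
    apply/(in_cylP c_lt); apply: etrans fc; apply: f_res.
    by apply/eq_res_addl0; rewrite resM res_expn mul0n mod0n.
  exists g => // n i lti; apply: (@z2_mulX2I q); apply: (addrI c%:R).
  have lt_i : (c + i * 2 ^ q < 2 ^ (q + n))%N.
    by rewrite mulnC; exact: (subcyl_lt c_lt (Ordinal lti)).
  have q0 : (0 < q + n)%N by rewrite /q addn1.
  (* The index [c + (i + 2 ^ n) * 2 ^ q] has leading digit [q + n], and removing it gives
     [c + i * 2 ^ q], again in the sphere. *)
  have := vdp_coefficient f_vdp q0 lt_i.
  have idx : (c + i * 2 ^ q + 2 ^ (q + n) = c + (i + 2 ^ n) * 2 ^ q)%N.
    by rewrite expnD mulnDl addnA [(2 ^ q * _)%N]mulnC.
  rewrite idx !(natrD _ c) !natrM !natrX ![_ * 2 ^+ q]mulrC !fg => ->.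
  by rewrite exprD mulrDr addrA mulrA.
rewrite sphere2_cyl //; split=> [erg|conds].
  have fc : res (f c%:R) q = c by case: erg => fS _ _; apply: fS; exists c%:R.
  have [g fg gb] := conj_g fc.
  have g_res := conjugate_res f_res fg.
  have fc0 : f c%:R = c%:R + 2 ^+ q * g 0 by rewrite -fg mulr0 addr0.
  apply/(vdp_conditionsP b fc0)/(odometerP g_res gb).
  exact: ergodic_odometer erg.
(* The first condition, reduced modulo [2 ^ q], already gives invariance of the sphere. *)
have fc : res (f c%:R) q = c.
  have [/z2_congrP fc1 _ _ _ _] := conds.
  rewrite (cyl_le _ fc1); last by rewrite leq_add2l.
  by rewrite res_natr -/c -/q modnDr modn_small.
have [g fg gb] := conj_g fc.
have g_res := conjugate_res f_res fg.
have fc0 : f c%:R = c%:R + 2 ^+ q * g 0 by rewrite -fg mulr0 addr0.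
move: conds => /(vdp_conditionsP b fc0)/(odometerP g_res gb).
exact: odometer_ergodic.
Qed.
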